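(* Let $r$ and $s$ be positive integers with $r \geq s \geq 3$. If $2s - 2 < r \leq 3s - 3$, then $f(s,r,3) = 6s + 2r - 6$.
   Context: For integers $a\le b$, $[a,b]=\{n\in\mathbb{N} : a\le n\le b\}$. For a finite set $X\subseteq\mathbb{N}$, $\mathrm{diam}(X)=\max(X)-\min(X)$. $f(s,r,3)$ denotes the smallest positive integer $n$ such that for every coloring $\Delta:[1,n]\to\{1,2,3\}$ there exist subsets $S_1,S_2\subseteq[1,n]$ with: (a) $S_1$ and $S_2$ each monochromatic (not necessarily of the same color); (b) $|S_1|=s$, $|S_2|=r$; (c) $\max(S_1)<\min(S_2)$; (d) $\mathrm{diam}(S_1)\le\mathrm{diam}(S_2)$. *)

(* Defs.v *)
From mathcomp Require Import all_boot finmap.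

Set Implicit Arguments.
Unset Strict Implicit.
Unset Printing Implicit Defensive.

Local Open Scope fset_scope.

(* Junk value 0 on the empty set. *)
Definition fmax (X : {fset nat}) : nat := \max_(x <- X) x.

(* The default [fmax X] dominates every element of [X], so it does not affect
   the minimum of a nonempty [X]. *)
Definition fmin (X : {fset nat}) : nat := \big[minn/fmax X]_(x <- X) x.

Definition diam (X : {fset nat}) : nat := fmax X - fmin X.

Definition monochromatic (k : nat) (Delta : nat -> 'I_k) (S : {fset nat}) :
    Prop :=
  exists c : 'I_k, forall x, x \in S -> Delta x = c.

Definition in_interval (a b : nat) (S : {fset nat}) : Prop :=
  forall x, x \in S -> a <= x <= b.

(* A k-coloring of [1,n] is represented by a function on all of nat; its values
   outside [1,n] play no role, since S1 and S2 are subsets of [1,n]. *)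
Definition arrows (s r k n : nat) : Prop :=
  forall Delta : nat -> 'I_k,
  exists S1 S2 : {fset nat},
    [/\ in_interval 1 n S1 /\ in_interval 1 n S2,
        monochromatic Delta S1 /\ monochromatic Delta S2,
        #|` S1| = s /\ #|` S2| = r,
        fmax S1 < fmin S2
      & diam S1 <= diam S2].

(* [is_f s r k n] means f(s,r,k) = n. It is a relation because f is not defined
   for all parameters: no n works for, e.g., s = 2 and r = 1. *)
Definition is_f (s r k n : nat) : Prop :=
  [/\ 0 < n,
      arrows s r k n
    & forall m, 0 < m -> arrows s r k m -> n <= m].

(* Main.v *)
Require Import Defs.
From mathcomp Require Import all_boot.
From mathcomp Require Import finmap zify.
From Stdlib Require Import Classical_Prop.

Set Implicit Arguments.
Unset Strict Implicit.
Unset Printing Implicit Defensive.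

(** Upper bound. Put [n = 6s+2r-6]. Some color has [s] elements in [1,3s-2];
    if the required pair does not exist, then every color which is "big", i.e.
    has at least [r] elements in [A = [3s-1,n]], has diameter at most [3s-4] in
    [A]. The first [s] elements of a big color then have diameter at most
    [3s-4-(r-s) < r-1], so no color can have [r] elements after them: every big
    color starts before the [s]-th element of every other one. Hence all
    elements of big colors lie within distance [7s-8-r] of each other (or
    [3s-4], if there is only one big color), and together with the at most
    [r-1] elements of each other color they are too few to fill [A].

    Lower bound. The coloring [1 0^(s-1) 2^(s-1) 1^(s-1) 0^(3s-3) 1^(r-1)
    2^(r-1)] of [1,6s+2r-7] has no such pair. *)

(** * Extrema, cardinality and diameter of finite sets of naturals *)

Section Fset.
Local Open Scope fset_scope.
Implicit Types (X : {fset nat}) (l : seq nat).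

Lemma leq_fmax X x : x \in X -> x <= fmax X.
Proof. by move=> xX; rewrite /fmax (big_rem x) //= leq_maxl. Qed.

Lemma fmax_leq X b : (forall x, x \in X -> x <= b) -> fmax X <= b.
Proof. by move=> Xb; rewrite /fmax; apply/bigmax_leqP_seq => x xX _; apply: Xb. Qed.

Lemma fmin_leq X x : x \in X -> fmin X <= x.
Proof.
rewrite /fmin; move: (fmax X) => d xX.
have {xX} : x \in (X : seq nat) by [].
elim: (X : seq nat) => //= y l IH.
rewrite big_cons !inE => /predU1P[->|/IH]; first exact: geq_minl.
by apply: leq_trans; exact: geq_minr.
Qed.

Lemma leq_fmin X a :
  X != fset0 -> (forall x, x \in X -> a <= x) -> a <= fmin X.
Proof.
case/fset0Pn=> y yX Xa; rewrite /fmin big_seq.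
elim/big_ind: _ => //; first exact: leq_trans (Xa _ yX) (leq_fmax yX).
by move=> u v ua va; rewrite leq_min ua.
Qed.

Lemma fmax_in X : X != fset0 -> fmax X \in X.
Proof.
case/fset0Pn=> y yX; apply: contraT => mX.
have : fmax X <= (fmax X).-1.
  apply: fmax_leq => x xX; have := leq_fmax xX.
  by case: (eqVneq x (fmax X)) => [e|]; [rewrite -e xX in mX|lia].
(* The predecessor is smaller only for a nonzero maximum; were the maximum 0, it would equal [y] and
   so be attained. *)
have : fmax X != 0; last lia.
apply: contra mX => /eqP m0; have := leq_fmax yX.
by rewrite m0 leqn0 => /eqP <-.
Qed.

Lemma fmin_in X : X != fset0 -> fmin X \in X.
Proof.
move=> X0; apply: contraT => mX.
suff : (fmin X).+1 <= fmin X by lia.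
apply: leq_fmin => // x xX; have := fmin_leq xX.
by case: (eqVneq x (fmin X)) => [e|]; [rewrite -e xX in mX|lia].
Qed.

Lemma cardfs_leq_size X l : (forall x, x \in X -> x \in l) -> #|` X| <= size l.
Proof. by move=> Xl; apply: uniq_leq_size. Qed.

Lemma card_seq_fset_uniq l : uniq l -> #|` [fset x in l]| = size l.
Proof. by move=> ul; rewrite card_fseq undup_id. Qed.

Lemma leq_diam X a b : a \in X -> b \in X -> b - a <= diam X.
Proof. by move=> /fmin_leq ? /leq_fmax ?; rewrite /diam; lia. Qed.

End Fset.

(** * Spread, extraction and color counts in lists *)

Section Seq.
Implicit Types l : seq nat.

Lemma uniq_size_spread l D :
  uniq l -> (forall a b, a \in l -> b \in l -> b <= a + D) -> size l <= D.+1.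
Proof.
move=> ul lD; case: l ul lD => // x0 l0; set l := x0 :: l0 => ul lD.
have ex : exists m, m \in l by exists x0; rewrite inE eqxx.
case: (ex_minnP ex) => m ml mmin.
rewrite -(size_iota m D.+1); apply: uniq_leq_size => // b bl.
by rewrite mem_iota; have := lD _ _ ml bl; have := mmin _ bl; lia.
Qed.

(** Serves to trim a color class to exactly [r] elements while keeping two points that witness a
    large diameter. *)
Lemma extract_with_endpoints l r a b :
  1 < r <= size l -> uniq l -> a \in l -> b \in l -> a < b ->
  exists l', [/\ uniq l', size l' = r, {subset l' <= l}, a \in l' & b \in l'].
Proof.
move=> rl ul al bl ab.
pose t := rem b (rem a l).
have bra : b \in rem a l by rewrite mem_rem_uniq // inE bl andbT; lia.
have st : size t = (size l).-2 by rewrite /t !size_rem.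
have ura : uniq (rem a l) by exact: rem_uniq.
have ut : uniq t by exact: rem_uniq.
have tP x : x \in take (r - 2) t -> [/\ x != a, x != b & x \in l].
  by move/mem_take; rewrite /t !(mem_rem_uniq, inE) // => /and3P[].
exists [:: a, b & take (r - 2) t]; split; rewrite ?inE ?eqxx ?orbT //.
- rewrite /= inE take_uniq // andbT negb_or.
  apply/andP; split; last by apply/negP => /tP[]; rewrite eqxx.
  by apply/andP; split; [lia|apply/negP => /tP[]; rewrite eqxx].
- by rewrite /= size_takel ?st; lia.
- by move=> x; rewrite !inE => /or3P[/eqP->|/eqP->|/tP[]].
Qed.

Lemma sorted_ltn_nth_leq l i j :
  sorted ltn l -> i <= j < size l -> nth 0 l i + (j - i) <= nth 0 l j.
Proof.
move=> sl /andP[ij jl]; elim: j ij jl => [|j IH] ij jl.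
  by have -> : i = 0; lia.
case: (eqVneq i j.+1) => [->|ne]; first by lia.
have /= := sorted_ltn_nth ltn_trans 0 sl j j.+1.
by rewrite !inE => /(_ ltac:(lia) jl ltac:(lia)); have := IH ltac:(lia) ltac:(lia); lia.
Qed.

Lemma size_color3 (Delta : nat -> 'I_3) l :
  size l = size [seq x <- l | Delta x == inord 0]
    + size [seq x <- l | Delta x == inord 1]
    + size [seq x <- l | Delta x == inord 2].
Proof.
elim: l => //= x l IH; rewrite !(fun_if size) /= -!val_eqE /= !inordK //.
by case: (Delta x) => [[|[|[|]]]] //= _; lia.
Qed.

End Seq.

(** * Pairs of sets for one fixed coloring *)

Definition arrow_pair (k : nat) (s r n : nat) (Delta : nat -> 'I_k) : Prop :=
  exists S1 S2 : {fset nat},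
    [/\ in_interval 1 n S1 /\ in_interval 1 n S2,
        monochromatic Delta S1 /\ monochromatic Delta S2,
        #|` S1|%fset = s /\ #|` S2|%fset = r,
        fmax S1 < fmin S2
      & diam S1 <= diam S2].

(** The window [[u, v]] bounds the diameter of the first set from above, and [a], [b] bound that of
    the second from below, so neither diameter has to be computed. *)
Lemma arrow_pair_seq k s r n (Delta : nat -> 'I_k) (c1 c2 : 'I_k)
    (l1 l2 : seq nat) u v a b :
  1 < s -> 1 < r ->
  uniq l1 -> size l1 = s ->
  (forall x, x \in l1 -> [/\ 1 <= x <= n, u <= x <= v & Delta x = c1]) ->
  uniq l2 -> r <= size l2 ->
  (forall x, x \in l2 -> [/\ 1 <= x <= n, v < x & Delta x = c2]) ->
  a \in l2 -> b \in l2 -> a < b -> v <= u + (b - a) ->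
  arrow_pair s r n Delta.
Proof.
move=> s1 r1 ul1 sl1 l1P ul2 sl2 l2P al bl ab vu.
have [|l [ul sl ll al' bl']] := @extract_with_endpoints l2 r a b _ ul2 al bl ab.
  by rewrite r1.
have lP x : x \in l -> [/\ 1 <= x <= n, v < x & Delta x = c2].
  by move/ll; exact: l2P.
have X0 (t : seq nat) : uniq t -> 0 < size t -> [fset x in t]%fset != fset0.
  by move=> ut t0; rewrite -cardfs_gt0 card_seq_fset_uniq.
have m1 : fmax [fset x in l1]%fset <= v.
  by apply: fmax_leq => x; rewrite inE => /l1P[]; lia.
exists [fset x in l1]%fset, [fset x in l]%fset; split.
- by split=> x; rewrite inE; [case/l1P|case/lP].
- by split; [exists c1|exists c2] => x; rewrite inE; [case/l1P|case/lP].
- by rewrite !card_seq_fset_uniq.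
- apply: (leq_ltn_trans m1); apply: leq_fmin; first by apply: X0; lia.
  by move=> x; rewrite inE => /lP[].
- have m2 : u <= fmin [fset x in l1]%fset.
    apply: leq_fmin; first by apply: X0; lia.
    by move=> x; rewrite inE => /l1P[]; lia.
  have := @leq_diam [fset x in l]%fset a b; rewrite !inE => /(_ al' bl').
  by rewrite /diam; lia.
Qed.

(** * Upper bound *)

Section Upper.
Variables (s r : nat) (Delta : nat -> 'I_3).
Hypotheses (hs : 3 <= s) (hr1 : 2 * s - 2 < r) (hr2 : r <= 3 * s - 3).

Let n := 6 * s + 2 * r - 6.
Let A := iota (3 * s - 1) (3 * s + 2 * r - 4).
Let L c := [seq x <- A | Delta x == c].

Let uniq_L c : uniq (L c). Proof. exact/filter_uniq/iota_uniq. Qed.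

Let sorted_L c : sorted ltn (L c).
Proof. by apply: (sorted_filter ltn_trans); exact: iota_ltn_sorted. Qed.

Let mem_L c x : x \in L c -> 3 * s - 1 <= x <= n /\ Delta x = c.
Proof. by rewrite mem_filter mem_iota => /andP[/eqP]; rewrite /n; split=> //; lia. Qed.

(** Pigeonhole: 3s-2 = 3(s-1)+1. *)
Lemma initial_monochromatic :
  exists c l, [/\ uniq l, size l = s
    & forall x, x \in l -> 1 <= x <= 3 * s - 2 /\ Delta x = c].
Proof.
pose l0 c := [seq x <- iota 1 (3 * s - 2) | Delta x == c].
have [c sc] : exists c, s <= size (l0 c).
  have := size_color3 Delta (iota 1 (3 * s - 2)); rewrite size_iota -!/(l0 _).
  case: (leqP s (size (l0 (inord 0)))) => [|h0]; first by exists (inord 0).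
  case: (leqP s (size (l0 (inord 1)))) => [|h1]; first by exists (inord 1).
  case: (leqP s (size (l0 (inord 2)))) => [|h2]; first by exists (inord 2).
  lia.
exists c, (take s (l0 c)); split.
- exact/take_uniq/filter_uniq/iota_uniq.
- by rewrite size_takel.
- by move=> x /mem_take; rewrite mem_filter mem_iota => /andP[/eqP]; split=> //; lia.
Qed.

Hypothesis nopair : ~ arrow_pair s r n Delta.

(** Two points of a big color at distance at least 3s-3, the width of [[1, 3s-2]], would complete
    the initial monochromatic set to a pair. *)
Lemma big_color_spread c a b :
  r <= size (L c) -> a \in L c -> b \in L c -> b <= a + (3 * s - 4).
Proof.
move=> rc ac bc; rewrite leqNgt; apply/negP => ab; apply: nopair.
have [c1 [l1 [ul1 sl1 l1P]]] := initial_monochromatic.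
apply: (@arrow_pair_seq _ _ _ _ _ c1 c l1 (L c) 1 (3 * s - 2) a b) => //; try lia.
- by move=> x /l1P[? ?]; split=> //; rewrite /n; lia.
- by move=> x /mem_L[? ?]; split=> //; lia.
Qed.

(** The bound is (4s-4-r) + (3s-4): from the first to the [s]-th element of [P], then from the first
    element of [Q], which comes no later, to [b]. The case [P = Q] is included. *)
Lemma big_colors_spread P Q a b :
  r <= size (L P) -> r <= size (L Q) -> a \in L P -> b \in L Q ->
  b <= a + (7 * s - 8 - r).
Proof.
move=> rP rQ aP bQ.
have inL c i : i < size (L c) -> nth 0 (L c) i \in L c by exact: mem_nth.
have start c x : x \in L c -> nth 0 (L c) 0 <= x.
  move=> xc; have := @sorted_ltn_nth_leq (L c) 0 (index x (L c)) (sorted_L c).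
  by rewrite nth_index // index_mem xc => /(_ isT); lia.
have spP := big_color_spread rP (inL P 0 ltac:(lia)) (inL P r.-1 ltac:(lia)).
have mid := @sorted_ltn_nth_leq _ s.-1 r.-1 (sorted_L P) ltac:(lia).
have := big_color_spread rQ (inL Q 0 ltac:(lia)) bQ.
have := start P a aP.
(* Otherwise the first [s] elements of [P], of diameter at most 4s-4-r, precede all of [L Q], of
   diameter at least r-1. *)
suff : nth 0 (L Q) 0 <= nth 0 (L P) s.-1 by lia.
rewrite leqNgt; apply/negP => PQ; apply: nopair.
have dQ := @sorted_ltn_nth_leq _ 0 r.-1 (sorted_L Q) ltac:(lia).
apply: (@arrow_pair_seq _ _ _ _ _ P Q (take s (L P)) (L Q)
  (nth 0 (L P) 0) (nth 0 (L P) s.-1) (nth 0 (L Q) 0) (nth 0 (L Q) r.-1)) => //;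
  try lia.
- exact: take_uniq.
- by rewrite size_takel; lia.
- move=> x xt; have xP := mem_take xt; have [? ?] := mem_L xP.
  have := start _ _ xP; have : x <= nth 0 (L P) s.-1; last by split=> //; lia.
  have sz : size (take s (L P)) = s by rewrite size_takel; lia.
  have is_ : index x (take s (L P)) < s by rewrite -[X in _ < X]sz index_mem.
  have := @sorted_ltn_nth_leq _ (index x (take s (L P))) s.-1 (sorted_L P) ltac:(lia).
  by rewrite -(nth_take 0 is_) nth_index //; lia.
- by move=> x xQ; have [? ?] := mem_L xQ; have := start _ _ xQ; split=> //; lia.
- by apply: inL; lia.
- by apply: inL; lia.
Qed.

Lemma no_pair_absurd : False.
Proof.
pose B := [seq x <- A | r <= size (L (Delta x))].
have size_B : size B <= 7 * s - 7 - r.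
  have -> : 7 * s - 7 - r = (7 * s - 8 - r).+1 by lia.
  apply: uniq_size_spread; first exact/filter_uniq/iota_uniq.
  move=> a b; rewrite !mem_filter => /andP[ra aA] /andP[rb bA].
  by apply: (big_colors_spread ra rb); rewrite mem_filter eqxx.
have size_big c : r <= size (L c) -> size (L c) <= 3 * s - 3.
  move=> rc; have -> : 3 * s - 3 = (3 * s - 4).+1 by lia.
  by apply: uniq_size_spread => // a b; exact: big_color_spread.
(* Membership in [B] depends only on the color, so [B] contains each class entirely or not at
   all. *)
have size_BE c : size [seq x <- B | Delta x == c]
    = if r <= size (L c) then size (L c) else 0.
  rewrite -filter_predI (@eq_filter _ _
    (fun x => (Delta x == c) && (r <= size (L c)))); last first.
    by move=> x /=; case: eqP => // ->.
  case: (r <= size (L c)).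
    by congr size; apply: eq_filter => x; rewrite andbT.
  by rewrite (@eq_filter _ _ pred0) ?filter_pred0 // => x; rewrite andbF.
have := size_color3 Delta A; rewrite size_iota -!/(L _).
move: size_B; rewrite (size_color3 Delta B) !size_BE.
have := size_big (inord 0); have := size_big (inord 1); have := size_big (inord 2).
(* With 0, 1, 2 or 3 big colors, [A] has at most 3r-3, (3s-3)+2(r-1), (7s-7-r)+(r-1) or 7s-7-r
   elements, each less than 3s+2r-4. *)
case: (leqP r (size (L (inord 0)))); case: (leqP r (size (L (inord 1))));
  case: (leqP r (size (L (inord 2)))); lia.
Qed.

End Upper.

(** * Lower bound: the extremal coloring *)

Section Lower.
Variables s r : nat.

Definition extremal_nat (x : nat) : nat :=
  if (1 < x <= s) || (3 * s - 1 <= x <= 6 * s - 5) then 0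
  else if [|| x == 1, 2 * s <= x <= 3 * s - 2
            | 6 * s - 4 <= x <= 6 * s + r - 6] then 1
  else 2.

Definition extremal_coloring (x : nat) : 'I_3 := inord (extremal_nat x).

Lemma extremal_monochromatic S : monochromatic extremal_coloring S ->
  exists2 c, c < 3 & forall x, x \in S -> extremal_nat x = c.
Proof.
case=> c Sc; exists (val c) => [|x /Sc <-]; first exact: ltn_ord.
rewrite /extremal_coloring /= inordK //.
by rewrite /extremal_nat; case: ifP => // _; case: ifP.
Qed.

(** Beyond 3s-2, colors 1 and 2 have only r-1 elements each, so [S] lies in the block [[3s-1, 6s-5]]
    of color 0. *)
Lemma extremal_tail N S : 3 <= s -> 0 < r -> 3 * s - 2 <= N ->
  monochromatic extremal_coloring S -> in_interval N.+1 (6 * s + 2 * r - 7) S ->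
  r <= #|` S|%fset ->
  r <= 6 * s - 5 - N /\ (forall x, x \in S -> x <= 6 * s - 5).
Proof.
move=> hs r0 hN /extremal_monochromatic[c c3 Sc] SN rS.
have [c0|[c1|c2]] : c = 0 \/ c = 1 \/ c = 2 by lia.
- have Sx x : x \in S -> N < x <= 6 * s - 5.
    by move=> xS; have := Sc _ xS; have := SN _ xS; rewrite c0 /extremal_nat;
      do 2?case: ifP; lia.
  split; last by move=> x /Sx; lia.
  apply: (leq_trans rS); rewrite -(size_iota N.+1 (6 * s - 5 - N)).
  by apply: cardfs_leq_size => x /Sx; rewrite mem_iota; lia.
- have : #|` S|%fset <= size (iota (6 * s - 4) (r - 1));
    last by rewrite size_iota; lia.
  apply: cardfs_leq_size => x xS; rewrite mem_iota.
  by have := Sc _ xS; have := SN _ xS; rewrite c1 /extremal_nat;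
      do 2?case: ifP; lia.
- have : #|` S|%fset <= size (iota (6 * s + r - 5) (r - 1));
    last by rewrite size_iota; lia.
  apply: cardfs_leq_size => x xS; rewrite mem_iota.
  by have := Sc _ xS; have := SN _ xS; rewrite c2 /extremal_nat;
      do 2?case: ifP; lia.
Qed.

(* Up to [4s-3] the coloring has period [3s-3], with [s-1] elements of each
   color in every period. *)
Lemma extremal_head u v S :
  3 <= s -> 1 <= u -> v <= 4 * s - 3 -> v < u + (3 * s - 3) ->
  monochromatic extremal_coloring S -> in_interval u v S -> #|` S|%fset < s.
Proof.
move=> hs u1 vs uv /extremal_monochromatic[c c3 Sc] Suv.
have bound (l : seq nat) :
    size l < s -> (forall x, x \in S -> x \in l) -> #|` S|%fset < s.
  by move=> ls Sl; exact: leq_ltn_trans (cardfs_leq_size Sl) ls.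
have [c0|[c1|c2]] : c = 0 \/ c = 1 \/ c = 2 by lia.
- have Sx x : x \in S -> u <= x <= v /\ ((1 < x <= s) || (3 * s - 1 <= x <= 4 * s - 3)).
    by move=> xS; have := Sc _ xS; have := Suv _ xS; rewrite c0 /extremal_nat;
      do 2?case: ifP; lia.
  have [us|us] := leqP u s; last first.
    by apply: (bound (iota (3 * s - 1) (s - 1))) => [|x /Sx];
      rewrite ?size_iota ?mem_iota; lia.
  have [vs'|vs'] := leqP (3 * s - 1) v; last first.
    by apply: (bound (iota 2 (s - 1))) => [|x /Sx];
      rewrite ?size_iota ?mem_iota; lia.
  (* The window meets both runs of color 0, but what it gains in the second it has lost in the
     first. The maximum skips 1, which has color 1. *)
  apply: (bound (iota (maxn u 2) (s.+1 - maxn u 2) ++ iota (3 * s - 1) (v - (3 * s - 2)))).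
    by rewrite size_cat !size_iota; lia.
  by move=> x /Sx; rewrite mem_cat !mem_iota; lia.
- have Sx x : x \in S -> u <= x <= v /\ ((x == 1) || (2 * s <= x <= 3 * s - 2)).
    by move=> xS; have := Sc _ xS; have := Suv _ xS; rewrite c1 /extremal_nat;
      do 2?case: ifP; lia.
  have [us|us] := leqP u 1; last first.
    by apply: (bound (iota (2 * s) (s - 1))) => [|x /Sx];
      rewrite ?size_iota ?mem_iota; lia.
  (* A window starting at 1 stops before 3s-2, the last element of the second run. *)
  apply: (bound (1 :: iota (2 * s) (s - 2))); first by rewrite /= size_iota; lia.
  by move=> x /Sx; rewrite inE mem_iota; lia.
- apply: (bound (iota s.+1 (s - 1))); first by rewrite size_iota; lia.
  move=> x xS; rewrite mem_iota.
  by have := Sc _ xS; have := Suv _ xS; rewrite c2 /extremal_nat;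
      do 2?case: ifP; lia.
Qed.

Lemma extremal_no_pair m : 3 <= s -> 2 * s - 2 < r -> m <= 6 * s + 2 * r - 7 ->
  ~ arrow_pair s r m extremal_coloring.
Proof.
move=> hs hr hm [S1 [S2 [[I1 I2] [M1 M2] [C1 C2] lt12 d12]]].
have S10 : S1 != fset0 by rewrite -cardfs_gt0 C1; lia.
have S20 : S2 != fset0 by rewrite -cardfs_gt0 C2; lia.
have S1uv : in_interval (fmin S1) (fmax S1) S1.
  by move=> x xS; rewrite fmin_leq // leq_fmax.
have u1 : 1 <= fmin S1 by have := I1 _ (fmin_in S10); lia.
have S2v : in_interval (fmax S1).+1 (6 * s + 2 * r - 7) S2.
  by move=> x xS; have := I2 _ xS; have := fmin_leq xS; lia.
have far : 3 * s - 2 <= fmax S1.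
  have [//|near] := leqP (3 * s - 2) (fmax S1).
  by have := extremal_head hs u1 _ _ M1 S1uv; lia.
have [||rle S2le] := extremal_tail hs _ far M2 S2v; try lia.
(* [S2] needs [r] > 2s-2 places between [fmax S1] and 6s-5. *)
have ge : fmax S1 <= 4 * s - 3 by lia.
have dS1 : fmin S1 + (3 * s - 3) <= fmax S1.
  rewrite leqNgt; apply/negP => near.
  by have := extremal_head hs u1 ge near M1 S1uv; lia.
(* [S2] lies in [[3s-1, 6s-5]], so its diameter is at most 3s-4, while that of [S1] is at least
   3s-3. *)
by have := S2le _ (fmax_in S20); move: d12; rewrite /diam; lia.
Qed.

End Lower.

Theorem theorem4p5 (r s : nat) (hs : 3 <= s) (hrs : s <= r)
    (hr1 : 2 * s - 2 < r) (hr2 : r <= 3 * s - 3) :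
  is_f s r 3 (6 * s + 2 * r - 6).
Proof.
split; first by lia.
- move=> Delta.
  have [//|nopair] := classic (arrow_pair s r (6 * s + 2 * r - 6) Delta).
  by case: (no_pair_absurd hs hr1 hr2 nopair).
- move=> m _ /(_ (extremal_coloring s r)) pair; rewrite leqNgt; apply/negP => lt_m.
  by apply: (@extremal_no_pair s r m) => //; lia.
Qed.
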